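(* Assume that $\rho_0(X)>0$ for $X\in\Omega_0^X$, that the energy density $F$ satisfies $F(s)\ge0$ for $s\ge0$, and that $\lim_{s\to0}F(\frac1s)s=\infty$. Let $n\ge1$ and let $\boldsymbol x^{n-1},\boldsymbol x^n\in S_{ad}$ be given. Consider the scheme: find $\boldsymbol x^{n+1}$ with $x_0^{n+1}=X_0$, $x_{M_x}^{n+1}=X_{M_x}$ such that, for $j=1,\dots,M_x-1$, $$ \begin{aligned} &\frac{1+2r_{n+1}}{2\tau_{n+1}(1+r_{n+1})}\rho_0(X_{j+\frac12})(x_{j+\frac12}^{n+1}-\hat x_{j+\frac12}^{n})h+\frac{1+2r_{n+1}}{2\tau_{n+1}(1+r_{n+1})}\rho_0(X_{j-\frac12})(x_{j-\frac12}^{n+1}-\hat x_{j-\frac12}^{n})h\\ &-\tau_{n+1}\frac{(x_{j+1}^{n+1}-x_{j+1}^{n})-2(x_j^{n+1}-x_j^{n})+(x_{j-1}^{n+1}-x_{j-1}^{n})}{h^2}h+\frac{\delta E_h}{\delta x_j}(\boldsymbol x^{n+1})=0, \end{aligned} $$ and set $\rho_{j+\frac12}^{n+1}=\dfrac{\rho_0(X_{j+\frac12})}{(D_hx^{n+1})_{j+\frac12}}$ for $j=0,\dots,M_x-1$. If $\frac{\delta^2E_h}{\delta\boldsymbol x^2}>0$, then the scheme has a unique solution $\boldsymbol x^{n+1}\in S_{ad}$, the solution is positive, i.e. $\rho_{j+\frac12}^{n+1}>0$ for $j=0,\dots,M_x-1$, and it is mass conservative. Moreover, if the time-step ratios satisfy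 $0<r_{k}\le r_{\max}\le\frac{3+\sqrt{17}}{2}$ for all $k$, the energy is dissipative: $$ E_h(\boldsymbol x^{n+1})+\frac{r_{\max}}{2\tau_{n+1}(1+r_{\max})}\left(\rho_0(\boldsymbol X)(\boldsymbol x^{n+1}-\boldsymbol x^{n})^2,1\right)_h \le E_h(\boldsymbol x^{n})+\frac{r_{\max}}{2\tau_{n}(1+r_{\max})}\left(\rho_0(\boldsymbol X)(\boldsymbol x^{n}-\boldsymbol x^{n-1})^2,1\right)_h. $$
   Context: This is a fully discrete Lagrangian scheme for a one-dimensional Wasserstein gradient flow $\partial_t\rho=\partial_x(\rho\,\partial_x\frac{\delta E}{\delta\rho})$ with $E(\rho)=\int_\Omega F(\rho)\,\mathrm{d}x$. $\Omega_0^X=[-L,L]$ with uniform grid $-L=X_0<\dots<X_{M_x}=L$, $h=2L/M_x$. For $\boldsymbol x=(x_0,\dots,x_{M_x})$: $x_{j+\frac12}=\frac12(x_j+x_{j+1})$, $(D_hx)_{j+\frac12}=\frac1h(x_{j+1}-x_j)$, and $(u,v)_h=\sum_{j=0}^{M_x-1}u_{j+\frac12}v_{j+\frac12}h$; in particular $(\rho_0(\boldsymbol X)\boldsymbol w^2,1)_h=\sum_{j=0}^{M_x-1}\rho_0(X_{j+\frac12})w_{j+\frac12}^2h$. Admissible set: $$S_{ad}=\{\boldsymbol x:\ x_{j+1}>x_j\ (j=0,\dots,M_x-1),\ x_0=X_0,\ x_{M_x}=X_{M_x}\}.$$ Discrete energy: $$E_h(\boldsymbol x)=\left(F\Big(\frac{\rho_0(\boldsymbol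 X)}{D_h\boldsymbol x}\Big),D_h\boldsymbol x\right)_h=\sum_{j=0}^{M_x-1}F\Big(\frac{\rho_0(X_{j+\frac12})}{(D_hx)_{j+\frac12}}\Big)(D_hx)_{j+\frac12}h ,$$ $\frac{\delta E_h}{\delta x_j}=\partial E_h/\partial x_j$, and $\frac{\delta^2E_h}{\delta\boldsymbol x^2}>0$ means that the Hessian of $E_h$ with respect to the interior unknowns is positive definite on $S_{ad}$ ($F$ is assumed smooth enough for this). Extrapolation: $\hat{\boldsymbol x}^{n}=\frac{(1+r_{n+1})^2}{1+2r_{n+1}}\boldsymbol x^{n}-\frac{r_{n+1}^2}{1+2r_{n+1}}\boldsymbol x^{n-1}$. Time steps $\tau_k=t^k-t^{k-1}>0$, $r_{k+1}=\tau_{k+1}/\tau_k$. Mass conservative means $\sum_{j=0}^{M_x-1}\rho_{j+\frac12}^{n+1}(x_{j+1}^{n+1}-x_j^{n+1})=\sum_{j=0}^{M_x-1}\rho_0(X_{j+\frac12})h$. The limit $s\to0$ is from the right. *)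

(* Defs.v *)
From HB Require Import structures.
From mathcomp Require Import all_boot all_order all_algebra.
From mathcomp Require Import all_classical all_reals all_analysis.
Import Order.TTheory GRing.Theory Num.Theory.
Import numFieldNormedType.Exports.

Set Implicit Arguments.
Unset Strict Implicit.
Unset Printing Implicit Defensive.

Local Open Scope classical_set_scope.
Local Open Scope ring_scope.

(* A grid function (x_0, ..., x_M) is a row vector in 'rV[R]_M.+1.  A function
   u on the half grid {1/2, ..., M - 1/2} is a map nat -> R, where u j stands
   for u_{j+1/2} and only the values with j < M are used. *)

Section Grid.
Variables (R : realType) (L : R) (M : nat).

(* [inord k] has value k for k <= M; larger k are never used. *)
Definition node (x : 'rV[R]_M.+1) (k : nat) : R := x 0 (inord k).

Definition meshsize : R := 2 * L / M%:R.

Definition grid : 'rV[R]_M.+1 := \row_(j < M.+1) (- L + j%:R * meshsize).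

Definition midpt (x : 'rV[R]_M.+1) (j : nat) : R :=
  2^-1 * (node x j + node x j.+1).

Definition Dh (x : 'rV[R]_M.+1) (j : nat) : R :=
  meshsize^-1 * (node x j.+1 - node x j).

Definition hdot (u v : nat -> R) : R := \sum_(j < M) u j * v j * meshsize.

Definition Sad (x : 'rV[R]_M.+1) : Prop :=
  [/\ forall j : nat, (j < M)%N -> node x j < node x j.+1,
      node x 0 = node grid 0 & node x M = node grid M].

(* rho_0(X)_{j+1/2} = rho_0(X_{j+1/2}) *)
Definition rho0h (rho0 : R -> R) (j : nat) : R := rho0 (midpt grid j).

Definition density (rho0 : R -> R) (x : 'rV[R]_M.+1) (j : nat) : R :=
  rho0h rho0 j / Dh x j.

Definition energy (F rho0 : R -> R) (x : 'rV[R]_M.+1) : R :=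
  hdot (fun j => F (density rho0 x j)) (Dh x).

Definition partial (f : 'rV[R]_M.+1 -> R) (k : nat) (x : 'rV[R]_M.+1) : R :=
  'D_(delta_mx 0 (inord k) : 'rV[R]_M.+1) f x.

(* The interior unknowns are x_1, ..., x_{M-1}: row i corresponds to x_{i+1}. *)
Definition hessian_int (f : 'rV[R]_M.+1 -> R) (x : 'rV[R]_M.+1) :
    'M[R]_(M.-1) :=
  \matrix_(i, j) partial (partial f j.+1) i.+1 x.

Definition wnorm2 (rho0 : R -> R) (w : 'rV[R]_M.+1) : R :=
  hdot (fun j => rho0h rho0 j * midpt w j ^+ 2) (fun=> 1).

Definition mass_conservative (rho0 : R -> R) (x : 'rV[R]_M.+1) : Prop :=
  \sum_(j < M) density rho0 x j * (node x j.+1 - node x j)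
  = \sum_(j < M) rho0h rho0 j * meshsize.

End Grid.

Definition posdefmx (R : realType) (m : nat) (A : 'M[R]_m) : Prop :=
  forall v : 'rV[R]_m, v != 0 -> 0 < (v *m A *m v^T) 0 0.

Definition twice_differentiable_pos (R : realType) (F : R -> R) : Prop :=
  forall s : R, 0 < s -> derivable F s 1 /\ derivable (derive1 F) s 1.

(* tau_k is used for k >= 1 and r_k for k >= 2 only. *)
Definition tau (R : realType) (t : nat -> R) (k : nat) : R := t k - t k.-1.

Definition step_ratio (R : realType) (t : nat -> R) (k : nat) : R :=
  tau t k / tau t k.-1.

Section Scheme.
Variables (R : realType) (L : R) (M : nat) (F rho0 : R -> R).
Variables (t : nat -> R) (n : nat).
(* xp, xc, x stand for x^{n-1}, x^n, x^{n+1}. *)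
Variables (xp xc : 'rV[R]_M.+1).

Definition extrapolation : 'rV[R]_M.+1 :=
  let r := step_ratio t n.+1 in
  ((1 + r) ^+ 2 / (1 + 2 * r)) *: xc - (r ^+ 2 / (1 + 2 * r)) *: xp.

Definition scheme_residual (x : 'rV[R]_M.+1) (j : nat) : R :=
  let r := step_ratio t n.+1 in
  let c := (1 + 2 * r) / (2 * tau t n.+1 * (1 + r)) in
  let h := meshsize L M in
  c * rho0h L M rho0 j * (midpt x j - midpt extrapolation j) * h
  + c * rho0h L M rho0 j.-1 * (midpt x j.-1 - midpt extrapolation j.-1) * h
  - tau t n.+1 * (((node x j.+1 - node xc j.+1)
                   - 2 * (node x j - node xc j)
                   + (node x j.-1 - node xc j.-1)) / h ^+ 2) * h
  + partial (energy L F rho0) j x.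

Definition scheme (x : 'rV[R]_M.+1) : Prop :=
  [/\ node x 0 = node (grid L M) 0,
      node x M = node (grid L M) M &
      forall j : nat, (1 <= j)%N -> (j < M)%N -> scheme_residual x j = 0].

End Scheme.

(* Main.v *)
Require Import Defs.
From HB Require Import structures.
From mathcomp Require Import all_boot all_order all_algebra.
From mathcomp Require Import all_classical all_reals all_analysis.
From mathcomp Require Import ring lra.
Import Order.TTheory GRing.Theory Num.Theory.
Import numFieldNormedType.Exports.
Set Implicit Arguments.
Unset Strict Implicit.
Unset Printing Implicit Defensive.
Local Open Scope classical_set_scope.
Local Open Scope ring_scope.

(** The scheme is the Euler-Lagrange system of the functional
      J(y) = c * sum_k rho_k (m_k(y) - m_k(xhat))^2 h
             + (tau/2) * sum_k (D_k(y) - D_k(xc))^2 h + E_h(y)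
    on meshes with fixed ends, where m_k is the midpoint value and D_k the
    difference quotient on cell k, c = (1 + 2r) / (2 tau (1 + r)), tau is the
    new time step and r its ratio to the previous one: the residual at node j
    is dJ(x) applied to the j-th unit vector
    ([scheme_residual_dobjective], [schemeP]).

    Every term of J is a sum of functions of one real variable composed with
    linear functionals (a sum of ridge functions).  All derivatives therefore
    reduce to derivatives of real functions along lines ([is_derive_line]).

    Existence ([objective_critical]).  The energy is a sum of nonnegative cell
    terms F(rho_k / s) s h with s = D_k(y), and each of them blows up as
    s -> 0+.  So meshes with J(y) <= J(xc) have all D_k(y) > e for some e > 0.
    The meshes with D_k >= e and fixed ends form a compact set on which J is
    continuous; its minimiser has D_k > e, hence it may be moved in every
    direction that fixes the ends, and dJ vanishes in these directions.

    Uniqueness ([denergy_increasing], [dobjective_increasing]).  The Hessian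
    form is the second derivative of E_h along lines.  Its positivity on the
    convex set of admissible meshes makes dE_h strictly monotone by the mean
    value theorem; the two quadratic terms are convex.

    Dissipation.  Test the Euler-Lagrange system with x - xc.  Convexity gives
    E_h(x) - E_h(xc) <= dE_h(x)(x - xc) ([energy_tangent]), the second
    difference term has a good sign, and since
    x - xhat = (x - xc) - r^2/(1+2r) (xc - xp), what is left is a quadratic
    form in the midpoint values a, b of x - xc and xc - xp in each cell.
    Young's inequality for the product a b reduces the claim to
    m/(1+m) <= (2 + 4r - r^2)/(1+r) for 0 < r <= m ([ratio_gap]), which at
    r = m says m^2 <= 3m + 2, i.e. m <= (3 + sqrt 17)/2 for m > 0. *)

(** * Derivatives along lines *)

Section LineDerivatives.
Variables (R : realType) (V : normedModType R).
Implicit Types (f : V -> R) (l : V -> R) (y v : V).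

(** A directional derivative only sees the restriction of the function to a
    line, which reduces everything below to functions of one real variable. *)
Lemma is_derive_line f y v (s d : R) :
  is_derive (s *: v + y) v f d <-> is_derive s 1 (fun r => f (r *: v + y)) d.
Proof.
have E : (fun h : R =>
      h^-1 *: ((f \o shift (s *: v + y)) (h *: v) - f (s *: v + y))) =
    (fun h : R =>
      h^-1 *: (((fun r => f (r *: v + y)) \o shift s) (h *: (1 : R)) -
               f (s *: v + y))).
  by apply/funext => h /=; rewrite [h *: (1 : R)]mulr1 scalerDl addrA.
split=> -[dv <-]; constructor.
- by rewrite /derivable -E.
- by rewrite /derive -E.
- by rewrite /derivable E.
- by rewrite /derive E.
Qed.

Lemma is_derive_mulr (phi : R -> R) (c s d : R) :
  is_derive s 1 phi d -> is_derive s 1 (fun u => phi u * c) (d * c).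
Proof.
move=> dphi; have -> : (fun u => phi u * c) = c *: phi.
  by apply/funext => u; rewrite mulrC.
by rewrite mulrC; exact: is_deriveZ.
Qed.

Lemma is_derive_ridge l (phi : R -> R) y v (d : R) : scalar l ->
  is_derive (l y) 1 phi d -> is_derive y v (fun z => phi (l z)) (d * l v).
Proof.
move=> lin dphi; rewrite -[y]add0r -(scale0r v); apply/is_derive_line.
have -> : (fun r => phi (l (r *: v + y))) = phi \o (fun r => r * l v + l y).
  by apply/funext => r /=; rewrite lin.
apply: is_derive1_comp; first by rewrite mul0r add0r.
have -> : (fun r : R => r * l v + l y) = (fun r : R => l v *: r) + cst (l y).
  by apply/funext => r /=; rewrite mulrC.
by apply: is_derive_eq; rewrite addr0 [_ *: _]mulr1.
Qed.

Lemma is_derive_ridge_sum (M : nat) (l : nat -> V -> R) (phi : nat -> R -> R)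
    (d : nat -> R) y v :
  (forall k, scalar (l k)) ->
  (forall k, (k < M)%N -> is_derive (l k y) 1 (phi k) (d k)) ->
  is_derive y v (fun z => \sum_(k < M) phi k (l k z)) (\sum_(k < M) d k * l k v).
Proof.
move=> lin dphi.
have -> : (fun z => \sum_(k < M) phi k (l k z)) =
   \sum_(k < M) (fun z => phi k (l k z)) by apply/funext => z; rewrite fct_sumE.
by apply: is_derive_sum => k; apply: is_derive_ridge => //; exact: dphi.
Qed.

(** Only directional derivatives along the segment are needed, so this applies
    to functions that are not known to be Frechet differentiable. *)
Lemma line_mvt f (df : V -> R) y v :
  (forall s : R, 0 <= s <= 1 -> is_derive (s *: v + y) v f (df (s *: v + y))) ->
  exists2 s : R, 0 < s < 1 & f (v + y) - f y = df (s *: v + y).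
Proof.
move=> dfP; pose g (s : R) := f (s *: v + y).
have dg (s : R) : 0 <= s <= 1 -> is_derive s 1 g (df (s *: v + y)).
  by move=> s01; apply/is_derive_line; exact: dfP.
have [||s] := @MVT R g (fun s => df (s *: v + y)) 0 1 ltr01.
- by move=> s /itvP s01; apply: dg; rewrite !s01.
- apply: derivable_within_continuous => s; rewrite in_itv /= => s01.
  by have [] := dg _ s01.
rewrite in_itv /= subr0 mulr1 /g scale1r scale0r add0r => s01 fE.
by exists s.
Qed.

End LineDerivatives.

Section RidgeContinuity.
Variables (R : realType) (V : normedModType R) (M : nat).
Variables (l : nat -> V -> R) (phi : nat -> R -> R) (y : V).
Hypothesis l_cont : forall k, continuous (l k).
Hypothesis dphi : forall k, (k < M)%N -> derivable (phi k) (l k y) 1.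

Lemma continuous_ridge_sum :
  {for y, continuous (fun z => \sum_(k < M) phi k (l k z))}.
Proof.
apply: cvg_big => [|k _]; first exact: add_continuous.
apply: (@continuous_comp _ _ _ (l k) (phi k)); first exact: l_cont.
exact/differentiable_continuous/derivable1_diffP/dphi.
Qed.

End RidgeContinuity.

Section QuadraticRidge.
Variables (R : realType) (V : normedModType R) (M : nat).
Variables (l : nat -> V -> R) (r e : nat -> R).

Definition quad (y : V) : R := \sum_(k < M) r k * (l k y - e k) ^+ 2.

Let is_derive_square k (s : R) :
  is_derive s 1 (fun u => r k * (u - e k) ^+ 2) (2 * r k * (s - e k)).
Proof.
have -> : (fun u => r k * (u - e k) ^+ 2) = r k *: ((id - cst (e k)) ^+ 2) by [].
by apply: is_derive_eq; rewrite subr0 /GRing.scale /= expr1 mulr1 mulrCA mulrA.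
Qed.

Lemma is_derive_quad y v : (forall k, scalar (l k)) ->
  is_derive y v quad (\sum_(k < M) 2 * r k * (l k y - e k) * l k v).
Proof.
move=> lin; by apply: (@is_derive_ridge_sum R V M l
  (fun k u => r k * (u - e k) ^+ 2) (fun k => 2 * r k * (l k y - e k))) .
Qed.

Lemma continuous_quad : (forall k, continuous (l k)) -> continuous quad.
Proof.
move=> l_cont y.
by apply: (@continuous_ridge_sum R V M l (fun k u => r k * (u - e k) ^+ 2)).
Qed.

End QuadraticRidge.

(** * Grid functions as linear functionals *)

Section GridFunctions.
Variables (R : realType) (L : R) (M : nat).
Implicit Types (x y w : 'rV[R]_M.+1).
Local Notation h := (meshsize L M).
Local Notation delta k := (delta_mx 0 (inord k) : 'rV[R]_M.+1).

Lemma node_scalar k : scalar (fun x => node x k).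
Proof. by move=> a u v; rewrite /node !mxE. Qed.

Lemma midpt_scalar k : scalar (fun x => midpt x k).
Proof. by move=> a u v; rewrite /midpt !node_scalar; ring. Qed.

Lemma Dh_scalar k : scalar (fun x => Dh L x k).
Proof. by move=> a u v; rewrite /Dh !node_scalar; ring. Qed.

Lemma nodeB x y k : node (x - y) k = node x k - node y k.
Proof. by rewrite /node !mxE. Qed.

Lemma midptB x y k : midpt (x - y) k = midpt x k - midpt y k.
Proof. by rewrite /midpt !nodeB; ring. Qed.

Lemma DhB x y k : Dh L (x - y) k = Dh L x k - Dh L y k.
Proof. by rewrite /Dh !nodeB; ring. Qed.

Lemma node_continuous k : continuous (fun x => node x k).
Proof. by move=> x; exact: (@coord_continuous R 1 M.+1 0 (inord k)). Qed.

Lemma midpt_continuous k : continuous (fun x => midpt x k).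
Proof.
move=> x; have Fx := nbhs_filter x.
by apply: cvgMl_tmp; apply: (@cvgD _ _ _ _ Fx (fun z => node z k)
  (fun z => node z k.+1)); exact: node_continuous.
Qed.

Lemma Dh_continuous k : continuous (fun x => Dh L x k).
Proof.
move=> x; have Fx := nbhs_filter x.
by apply: cvgMl_tmp; apply: (@cvgB _ _ _ _ Fx (fun z => node z k.+1)
  (fun z => node z k)); exact: node_continuous.
Qed.

Lemma hdot_scalar (a : nat -> R) (l : 'rV[R]_M.+1 -> nat -> R) :
  (forall k, scalar (fun z => l z k)) -> scalar (fun z => hdot L M a (l z)).
Proof.
move=> lin b u v; rewrite /hdot mulr_sumr -big_split /=.
by apply: eq_bigr => k _; rewrite lin; ring.
Qed.

Lemma node_delta j k : (j <= M)%N -> (k <= M)%N ->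
  node (delta j) k = (k == j)%:R.
Proof.
move=> jM kM; rewrite /node mxE eqxx /=; congr (nat_of_bool _)%:R.
by rewrite -val_eqE /= !inordK.
Qed.

Definition fixed_ends w := node w 0 = 0 /\ node w M = 0.

(** Turns statements tested on the interior unit vectors (the equations of the
    scheme, the entries of the Hessian) into statements about all perturbations
    that keep the ends fixed. *)
Lemma scalar_interior_sum (f : 'rV[R]_M.+1 -> R) w : (0 < M)%N ->
  scalar f -> fixed_ends w ->
  f w = \sum_(i < M.-1) node w i.+1 * f (delta i.+1).
Proof.
move=> M0 lin [w0 wM].
have [g ->] : exists g : {scalar 'rV[R]_M.+1}, f = g.
  pose fL := GRing.isLinear.Build _ _ _ _ f lin.
  by exists (HB.pack f fL : {scalar _}).
rewrite [in LHS](row_sum_delta w) linear_sum.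
under eq_bigr do rewrite linearZ.
case: M M0 w w0 wM f lin g => // m _ w w0 wM f lin g.
have e0 : inord 0 = ord0 :> 'I_m.+2 by apply/val_inj; rewrite /= inordK.
have eM : inord m.+1 = lift ord0 ord_max :> 'I_m.+2.
  by apply/val_inj; rewrite /= inordK.
move: w0 wM; rewrite /node e0 eM => w0 wM.
rewrite big_ord_recl big_ord_recr /= w0 wM !mul0r add0r addr0.
apply: eq_bigr => i _.
suff -> : lift ord0 (widen_ord (leqnSn m) i) = inord i.+1 :> 'I_m.+2 by [].
by apply/val_inj; rewrite /= inordK // ltnS ltnW // ltnS.
Qed.

End GridFunctions.

(** * The energy of one cell *)

Section CellEnergy.
Variable R : realType.
Implicit Types (F : R -> R) (r s : R).

(** The contribution of one cell with initial density r and stretching s = D_h x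
    to the energy, up to the factor h. *)
Definition cell F r s : R := F (r / s) * s.

Lemma is_derive_div r s : s != 0 ->
  is_derive s 1 (fun u => r / u) (- (r / s ^+ 2)).
Proof.
move=> s0.
have dV : derivable (fun u : R => u^-1) s 1 by apply: derivableV.
have -> : (fun u => r / u) = r *: (fun u : R => u^-1) by [].
apply: DeriveDef; first exact: derivableZ.
rewrite deriveZ // deriveV // derive_id /GRing.scale /= mulr1.
by rewrite exprnN mulrN.
Qed.

Lemma is_derive_cell F r s : 0 < r -> 0 < s -> derivable F (r / s) 1 ->
  is_derive s 1 (cell F r) (F (r / s) - derive1 F (r / s) * (r / s)).
Proof.
move=> r0 s0 dF; have sn0 := lt0r_neq0 s0.
have dFr : is_derive s 1 (fun u => F (r / u)) (derive1 F (r / s) * - (r / s ^+ 2)).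
  apply: (@is_derive1_comp _ F (fun u => r / u)); last exact: is_derive_div.
  by rewrite derive1E; exact/derivableP.
have -> : cell F r = (fun u => F (r / u)) * id by [].
by apply: is_derive_eq; rewrite /GRing.scale /=; field.
Qed.

(** The first derivative of the cell energy is an expression in F and F' that
    can be derived once more; the closed form holds only for positive
    arguments, hence the passage through a neighbourhood. *)
Lemma cell_twice_derivable F r s : twice_differentiable_pos F -> 0 < r ->
  0 < s -> derivable (cell F r) s 1 /\ derivable (derive1 (cell F r)) s 1.
Proof.
move=> F2 r0 s0; have rs u : 0 < u -> 0 < r / u by move=> u0; exact: divr_gt0.
split; first by have [] := is_derive_cell r0 s0 (F2 _ (rs _ s0)).1.
have [dF dF'] := F2 _ (rs _ s0); have sn0 := lt0r_neq0 s0.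
pose g u := F (r / u) - derive1 F (r / u) * (r / u).
have dcell : \forall u \near s, g u = (derive1 (cell F r)) u.
  near=> u; have u0 : 0 < u by near: u; exact: lt_nbhsr.
  by rewrite derive1E; have [_ ->] := is_derive_cell r0 u0 (F2 _ (rs _ u0)).1.
have ddiv : derivable (fun u : R => r / u) s 1 by have [] := is_derive_div r sn0.
have comp (G : R -> R) :
    derivable G (r / s) 1 -> derivable (fun u : R => G (r / u)) s 1.
  move=> dG; have dGr := derivableP dG.
  by have [] := @is_derive1_comp _ G _ s _ _ dGr (derivableP ddiv).
have dg : derivable g s 1.
  have -> : g = (fun u => F (r / u)) - (fun u => derive1 F (r / u)) * (fun u => r / u).
    by [].
  exact: derivableB (comp _ dF) (derivableM (comp _ dF') ddiv).
by have [] := near_eq_is_derive dcell (derivableP dg).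
Unshelve. all: by end_near. Qed.

(** With u = s / r the cell energy is r times F(1/u) u, so the growth
    condition on F passes to every cell whatever its density. *)
Lemma cell_blowup F r (A : R) : 0 < r ->
  (F (1 / s) * s @[s --> 0^'+] --> +oo%R) ->
  \forall e \near 0^'+, forall s, 0 < s <= e -> A < cell F r s.
Proof.
move=> r0 /cvgryPgt/(_ (A / r)) Fblow.
have [d /= d0 dF] : exists2 d, 0 < d & forall u, 0 < u < d -> A / r < F (1 / u) * u.
  have /nbhs_ballP[d /= d0 dF] := Fblow; exists d => // u /andP[u0 ud].
  by apply: dF => //=; rewrite /ball /= sub0r normrN gtr0_norm.
near=> e => s /andP[s0 se].
have /dF : 0 < s / r < d.
  rewrite divr_gt0 //= ltr_pdivrMr //; apply: (le_lt_trans se).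
  by near: e; apply: nbhs_right_lt; exact: mulr_gt0.
rewrite ltr_pdivrMr // /cell; congr (A < _).
have -> : 1 / (s / r) = r / s by field; rewrite !lt0r_neq0.
by field; rewrite lt0r_neq0.
Unshelve. all: by end_near. Qed.

End CellEnergy.

(** * First and second derivatives of the discrete energy *)

Section DiscreteEnergy.
Variables (R : realType) (L : R) (M : nat) (F rho0 : R -> R).
Hypothesis L_gt0 : 0 < L.
Hypothesis M_gt0 : (0 < M)%N.
Hypothesis rho0_gt0 : forall X : R, - L <= X <= L -> 0 < rho0 X.
Hypothesis F_smooth : twice_differentiable_pos F.
Implicit Types (x y u w : 'rV[R]_M.+1).
Local Notation h := (meshsize L M).
Local Notation rho k := (rho0h L M rho0 k).
Local Notation E := (energy L F rho0 : 'rV[R]_M.+1 -> R).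
Local Notation delta k := (delta_mx 0 (inord k) : 'rV[R]_M.+1).

Lemma meshsize_gt0 : 0 < h.
Proof. by rewrite /meshsize divr_gt0 ?ltr0n // mulr_gt0. Qed.

Lemma grid_node k : (k <= M)%N -> node (grid L M) k = - L + k%:R * h.
Proof. by move=> kM; rewrite /node mxE inordK. Qed.

Lemma rho0h_gt0 k : (k < M)%N -> 0 < rho k.
Proof.
move=> kM; apply: rho0_gt0; rewrite /midpt !grid_node // 1?ltnW //.
have h0 := meshsize_gt0.
have hM : M%:R * h = 2 * L.
  by rewrite /meshsize; field; rewrite pnatr_eq0 -lt0n.
have k0 : 0 <= k%:R * h by rewrite mulr_ge0 // ltW.
have kM' : k.+1%:R * h <= 2 * L by rewrite -hM ler_pM2r // ler_nat.
move: kM'; rewrite -natr1 mulrDl mul1r; move: k0; set q := k%:R * h => q0 qL.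
by apply/andP; split; lra.
Qed.

(** Admissibility without the boundary conditions: unlike the admissible set
    this is open, so partial derivatives make sense there. *)
Definition uncrossed y := forall k, (k < M)%N -> 0 < Dh L y k.

Lemma Dh_gt0 y k : (0 < Dh L y k) = (node y k < node y k.+1).
Proof. by rewrite /Dh pmulr_rgt0 ?invr_gt0 ?meshsize_gt0 // subr_gt0. Qed.

Lemma Sad_uncrossed y : Sad L y -> uncrossed y.
Proof. by case=> y_lt _ _ k kM; rewrite Dh_gt0; exact: y_lt. Qed.

Lemma near_uncrossed y : uncrossed y -> \forall z \near y, uncrossed z.
Proof.
move=> y0; have Fy := nbhs_filter y.
have : \forall z \near y, forall k : 'I_M, 0 < Dh L z k.
  apply: (@filter_forall _ _ _ (nbhs y) Fy) => k.
  exact: (@Dh_continuous R L M k y _ (lt_nbhsr (y0 k (ltn_ord k)))).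
by apply: filterS => z z0 k kM; exact: (z0 (Ordinal kM)).
Qed.

(** First and second derivatives of the energy at y, in directions w and
    (u, w); see [is_derive_energy] and [is_derive_denergy]. *)
Definition denergy y w :=
  hdot L M (fun k => derive1 (cell F (rho k)) (Dh L y k)) (Dh L w).

Definition d2energy y u w :=
  hdot L M (fun k => derive1 (derive1 (cell F (rho k))) (Dh L y k) * Dh L u k)
    (Dh L w).

Lemma is_derive_energy y w : uncrossed y -> is_derive y w E (denergy y w).
Proof.
move=> y0.
have -> : E = fun z => \sum_(k < M) cell F (rho k) (Dh L z k) * h by [].
have -> : denergy y w =
    \sum_(k < M) (derive1 (cell F (rho k)) (Dh L y k) * h) * Dh L w k.
  by apply: eq_bigr => k _; rewrite mulrAC.
apply: (@is_derive_ridge_sum R 'rV[R]_M.+1 M (fun k z => Dh L z k)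
  (fun k s => cell F (rho k) s * h)
  (fun k => derive1 (cell F (rho k)) (Dh L y k) * h)) => [k|k kM].
  exact: Dh_scalar.
have [dc _] := cell_twice_derivable F_smooth (rho0h_gt0 kM) (y0 k kM).
by apply: is_derive_mulr; rewrite derive1E; exact: derivableP.
Qed.

Lemma is_derive_denergy y u w : uncrossed y ->
  is_derive y u (denergy ^~ w) (d2energy y u w).
Proof.
move=> y0; pose f k : R -> R := derive1 (cell F (rho k)).
have -> : denergy ^~ w = fun z => \sum_(k < M) f k (Dh L z k) * (Dh L w k * h).
  by apply: funext => z; rewrite /denergy /hdot;
    apply: eq_bigr => k _; rewrite mulrA.
have -> : d2energy y u w =
    \sum_(k < M) (derive1 (f k) (Dh L y k) * (Dh L w k * h)) * Dh L u k.
  apply: eq_bigr => k _; rewrite -/(f k).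
  by rewrite -[in LHS]mulrA [in LHS]mulrAC.
apply: (@is_derive_ridge_sum R 'rV[R]_M.+1 M (fun k z => Dh L z k)
  (fun k s => f k s * (Dh L w k * h))
  (fun k => derive1 (f k) (Dh L y k) * (Dh L w k * h))) => [k|k kM].
  exact: Dh_scalar.
have [_ dc] := cell_twice_derivable F_smooth (rho0h_gt0 kM) (y0 k kM).
by apply: is_derive_mulr; rewrite derive1E; exact: derivableP.
Qed.

(** The partial derivatives of the Hessian are taken of functions that agree
    with [denergy] only near y; bilinearity of [d2energy] then assembles the
    entries. *)
Lemma hessian_intE y w : uncrossed y -> fixed_ends w ->
  let v := \row_(i < M.-1) node w i.+1 in
  (v *m hessian_int E y *m v^T) 0 0 = d2energy y w w.
Proof.
move=> y0 w0 v.
have HE i j : hessian_int E y i j = d2energy y (delta i.+1) (delta j.+1).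
  rewrite mxE /partial.
  have [_ <-] := is_derive_denergy (delta i.+1) (delta j.+1) y0.
  apply: near_eq_derive; have Fy := nbhs_filter y.
  apply: filterS (near_uncrossed y0) => z z0.
  by have [_ ->] := is_derive_energy (delta j.+1) z0.
have lin u : scalar (fun z => d2energy y u z).
  by apply: hdot_scalar => k; exact: Dh_scalar.
have lin' u : scalar (fun z => d2energy y z u).
  move=> a u1 u2; rewrite /d2energy /hdot mulr_sumr -big_split /=.
  by apply: eq_bigr => k _; rewrite Dh_scalar; ring.
rewrite (scalar_interior_sum M_gt0 (lin w) w0) mxE; apply: eq_bigr => j _.
rewrite (scalar_interior_sum M_gt0 (lin' _) w0) !mxE mulrC.
by congr (_ * _); apply: eq_bigr => i _; rewrite HE mxE.
Qed.

Lemma fixed_ends_eq0 w : fixed_ends w ->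
  \row_(i < M.-1) node w i.+1 = 0 -> w = 0.
Proof.
move=> w0 v0; apply/rowP => k; rewrite mxE.
have := scalar_interior_sum M_gt0 (@node_scalar R M k) w0.
rewrite {1}/node inord_val => ->; rewrite big1 // => i _.
by move/rowP: v0 => /(_ i); rewrite !mxE => ->; rewrite mul0r.
Qed.

Lemma fixed_endsB x y : Sad L x -> Sad L y -> fixed_ends (y - x).
Proof.
by case=> _ x0 xM [_ y0 yM]; split; rewrite nodeB ?x0 ?xM ?y0 ?yM subrr.
Qed.

Lemma Sad_segment x y s : Sad L x -> Sad L y -> 0 <= s <= 1 ->
  Sad L (s *: (y - x) + x).
Proof.
move=> [x_lt x0 xM] [y_lt y0 yM] /andP[s0 s1].
split; rewrite ?node_scalar ?nodeB ?x0 ?xM ?y0 ?yM ?subrr ?mulr0 ?add0r //.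
move=> k kM; rewrite !node_scalar !nodeB; have := x_lt k kM; have := y_lt k kM.
set a := node x k; set b := node x k.+1; set c := node y k; set d := node y k.+1.
move=> cd ab; rewrite -subr_gt0.
(* The gap of a convex combination is the convex combination of the gaps. *)
have -> : s * (d - b) + b - (s * (c - a) + a) = s * (d - c) + (1 - s) * (b - a).
  by ring.
have : 0 < s \/ s = 0 by move: s0; rewrite le_eqVlt => /orP[/eqP|]; [right|left].
case=> [s_gt0|->]; last by lra.
by apply: ltr_wpDr; rewrite ?mulr_ge0 ?mulr_gt0 ?subr_ge0 ?subr_gt0 // ltW.
Qed.

Hypothesis hess_gt0 : forall y, Sad L y -> posdefmx (hessian_int E y).

Lemma d2energy_gt0 y w : Sad L y -> fixed_ends w -> w != 0 ->
  0 < d2energy y w w.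
Proof.
move=> y_ad w0 wn0; rewrite -(hessian_intE (Sad_uncrossed y_ad) w0).
by apply: hess_gt0 => //; apply: contra_neq wn0 => /(fixed_ends_eq0 w0).
Qed.

(** Strict monotonicity of the gradient: the mean value theorem for dE_h
    along the segment, which stays admissible. *)
Lemma denergy_increasing x y : Sad L x -> Sad L y -> x != y ->
  denergy x (y - x) < denergy y (y - x).
Proof.
move=> x_ad y_ad xy; set w := y - x.
have [s sle|s s01] := @line_mvt R _ (denergy ^~ w) (fun z => d2energy z w w) x w.
  by apply: is_derive_denergy; exact/Sad_uncrossed/Sad_segment.
rewrite subrK -subr_gt0 => ->; apply: d2energy_gt0.
- by apply: Sad_segment => //; case/andP: s01 => /ltW -> /ltW ->.
- exact: fixed_endsB.
- by rewrite subr_eq0 eq_sym.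
Qed.

Lemma denergy_scalar y : scalar (fun w => denergy y w).
Proof. by apply: hdot_scalar => k; exact: Dh_scalar. Qed.

(** The mean value theorem produces the slope at an intermediate point z, which
    monotonicity of the gradient between z and y bounds by the slope at y. *)
Lemma energy_tangent x y : Sad L x -> Sad L y ->
  E y - E x <= denergy y (y - x).
Proof.
move=> x_ad y_ad; set w := y - x.
have [s sle|s /andP[s0 s1]] := @line_mvt R _ E (fun z => denergy z w) x w.
  by apply: is_derive_energy; exact/Sad_uncrossed/Sad_segment.
rewrite subrK => ->; set z := s *: w + x.
have z_ad : Sad L z by apply: Sad_segment; rewrite ?ltW.
have [->//|zy] := eqVneq z y.
have yz : y - z = (1 - s) *: w + 0.
  by rewrite addr0 scalerBl scale1r /z /w opprD addrA addrAC.
have := denergy_increasing z_ad y_ad zy.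
have d0 u : denergy u 0 = 0.
  by have := denergy_scalar u (-1) 0 0; rewrite scaler0 addr0 mulN1r addNr.
by rewrite yz !denergy_scalar !d0 !addr0 ltr_pM2l ?subr_gt0 // => /ltW.
Qed.

End DiscreteEnergy.

(** * The functional whose gradient is the scheme *)

Section Objective.
Variables (R : realType) (L : R) (M : nat) (F rho0 : R -> R).
Hypothesis L_gt0 : 0 < L.
Hypothesis M_gt0 : (0 < M)%N.
Hypothesis rho0_gt0 : forall X : R, - L <= X <= L -> 0 < rho0 X.
Hypothesis F_smooth : twice_differentiable_pos F.
Variables (c s : R) (a b : 'rV[R]_M.+1).
Implicit Types (x y u w : 'rV[R]_M.+1).
Local Notation h := (meshsize L M).
Local Notation rho k := (rho0h L M rho0 k).
Local Notation E := (energy L F rho0 : 'rV[R]_M.+1 -> R).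

(** The functional J, with arbitrary weights c and s and reference meshes a (the
    extrapolation) and b (the current mesh). *)
Definition objective y :=
  c * wnorm2 L rho0 (y - a)
  + s / 2 * hdot L M (Dh L (y - b)) (Dh L (y - b)) + E y.

Definition dobjective y w :=
  2 * c * hdot L M (fun k => rho k * midpt (y - a) k) (midpt w)
  + s * hdot L M (Dh L (y - b)) (Dh L w) + denergy L F rho0 y w.

Lemma objectiveE : objective =
  c *: quad M (fun k z => midpt z k) (fun k => rho k * h) (midpt a)
  + (s / 2) *: quad M (fun k z => Dh L z k) (fun=> h) (Dh L b) + E.
Proof.
apply/funext => y; rewrite /objective; congr (_ * _ + _ * _ + _).
  by apply: eq_bigr => k _; rewrite midptB mulr1 mulrAC.
by apply: eq_bigr => k _; rewrite DhB mulrC expr2.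
Qed.

Lemma is_derive_objective y w : uncrossed L y ->
  is_derive y w objective (dobjective y w).
Proof.
move=> y0; rewrite objectiveE.
have -> : dobjective y w =
    c *: (\sum_(k < M) 2 * (rho k * h) * (midpt y k - midpt a k) * midpt w k)
    + (s / 2) *: (\sum_(k < M) 2 * h * (Dh L y k - Dh L b k) * Dh L w k)
    + denergy L F rho0 y w.
  rewrite /dobjective /hdot /GRing.scale /= !mulr_sumr.
  congr (_ + _ + _); apply: eq_bigr => k _; rewrite ?midptB ?DhB; first by ring.
  by field.
apply: is_deriveD; last exact: is_derive_energy.
apply: is_deriveD; apply: is_deriveZ; apply: is_derive_quad => k.
  exact: midpt_scalar.
exact: Dh_scalar.
Qed.

Lemma energy_continuous y : uncrossed L y -> {for y, continuous E}.
Proof.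
move=> y0; have -> : E = fun z => \sum_(k < M) cell F (rho k) (Dh L z k) * h by [].
apply: (@continuous_ridge_sum R 'rV[R]_M.+1 M (fun k z => Dh L z k)
  (fun k e => cell F (rho k) e * h)) => [k|k kM]; first exact: Dh_continuous.
have rho_gt0 := rho0h_gt0 L_gt0 M_gt0 rho0_gt0 kM.
have [dc _] := cell_twice_derivable F_smooth rho_gt0 (y0 k kM).
by have [] := is_derive_mulr h (derivableP dc).
Qed.

Lemma objective_continuous y : uncrossed L y -> {for y, continuous objective}.
Proof.
move=> y0; rewrite objectiveE.
apply: continuousD; last exact: energy_continuous.
apply: continuousD; apply: continuousZl_tmp; apply: continuous_quad => k.
  exact: midpt_continuous.
exact: Dh_continuous.
Qed.

Lemma dobjective_scalar y : scalar (fun w => dobjective y w).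
Proof.
move=> e u v; rewrite /dobjective.
have m1 f := @hdot_scalar R L M f (fun w => midpt w) (@midpt_scalar R M).
have m2 f := @hdot_scalar R L M f (fun w => Dh L w) (@Dh_scalar R L M).
by rewrite m1 m2 denergy_scalar; ring.
Qed.

(** The quadratic part of J has a monotone gradient: the difference is a sum of
    squares with nonnegative weights. *)
Lemma dobjective_increasing x y : 0 <= c -> 0 <= s ->
  dobjective y (y - x) - dobjective x (y - x) >=
  denergy L F rho0 y (y - x) - denergy L F rho0 x (y - x).
Proof.
move=> c0 s0; have h0 := meshsize_gt0 L_gt0 M_gt0.
rewrite -subr_ge0 /dobjective.
have -> : forall A B C A' B' C' : R,
    A + B + C - (A' + B' + C') - (C - C') = (A - A') + (B - B').
  by move=> *; ring.
rewrite -!mulrBr /hdot -!sumrB; apply: addr_ge0; apply: mulr_ge0 => //.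
    by rewrite mulr_ge0.
  apply: sumr_ge0 => k _; rewrite !midptB.
  have r0 := rho0h_gt0 L_gt0 M_gt0 rho0_gt0 (ltn_ord k).
  set p := midpt y k; set q := midpt x k; set m := midpt a k.
  have -> : rho k * (p - m) * (p - q) * h - rho k * (q - m) * (p - q) * h =
    rho k * (p - q) ^+ 2 * h by ring.
  by apply: mulr_ge0; [apply: mulr_ge0|]; rewrite ?sqr_ge0 ?ltW.
apply: sumr_ge0 => k _; rewrite !DhB.
set p := Dh L y k; set q := Dh L x k; set m := Dh L b k.
have -> : (p - m) * (p - q) * h - (q - m) * (p - q) * h = (p - q) ^+ 2 * h by ring.
by apply: mulr_ge0; rewrite ?sqr_ge0 ?ltW.
Qed.

End Objective.

(** * Existence of a critical point *)

Section Minimiser.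
Variables (R : realType) (L : R) (M : nat) (F rho0 : R -> R).
Hypothesis L_gt0 : 0 < L.
Hypothesis M_gt0 : (0 < M)%N.
Hypothesis rho0_gt0 : forall X : R, - L <= X <= L -> 0 < rho0 X.
Hypothesis F_ge0 : forall s : R, 0 <= s -> 0 <= F s.
Hypothesis F_smooth : twice_differentiable_pos F.
Hypothesis F_lim : F (1 / s) * s @[s --> 0^'+] --> +oo%R.
Implicit Types (x y z w : 'rV[R]_M.+1).
Local Notation h := (meshsize L M).
Local Notation rho k := (rho0h L M rho0 k).
Local Notation E := (energy L F rho0 : 'rV[R]_M.+1 -> R).

(** The compact set on which J is minimised.  The lower bound on the stretching
    replaces the strict inequalities of the admissible set, which is not
    closed. *)
Definition separated (e : R) : set 'rV[R]_M.+1 :=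
  [set y | [/\ forall k, (k < M)%N -> e <= Dh L y k,
      node y 0 = node (grid L M) 0 & node y M = node (grid L M) M]].

Lemma separated_uncrossed e y : 0 < e -> separated e y -> uncrossed L y.
Proof. by move=> e0 [ey _ _] k kM; exact: lt_le_trans (ey k kM). Qed.

Lemma separated_Sad e y : 0 < e -> separated e y -> Sad L y.
Proof.
move=> e0 ey; have y0 := separated_uncrossed e0 ey.
by case: ey => _ y_0 y_M; split=> // k kM; rewrite -(Dh_gt0 L_gt0 M_gt0) y0.
Qed.

(** Nodes are increasing, so all of them lie between the fixed ends; the
    conditions themselves are closed. *)
Lemma compact_separated e : 0 < e -> compact (separated e).
Proof.
move=> e0.
pose m0 := node (grid L M) 0; pose m1 := node (grid L M) M.
apply: (@subclosed_compact _ _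
  [set v : 'rV[R]_M.+1 | forall i, `[m0, m1]%classic (v ord0 i)]); last first.
- move=> y /(separated_Sad e0)[y_lt y_0 y_M] i /=; rewrite in_itv /=.
  have mono : {in [pred k | (k <= M)%N] &, {homo node y : i j / (i <= j)%N >-> i <= j}}.
    apply: homo_leq_in => [z|p q z|p q|p]; [exact: lexx|exact: le_trans| |].
      by rewrite !inE => _ qM k /andP[_ /ltnW/leq_trans]; apply.
    by rewrite !inE => _ pM; rewrite ltW // y_lt.
  have iM : (i <= M)%N by rewrite -ltnS.
  have yi : y ord0 i = node y i by rewrite /node inord_val.
  by rewrite yi /m0 /m1 -y_0 -y_M !mono // inE.
- by apply: (@rV_compact R M.+1 (fun=> `[m0, m1]%classic)) => i; exact: segment_compact.
have -> : separated e =
    \bigcap_(k in [set k | (k < M)%N]) ((fun y => Dh L y k) @^-1` [set u | e <= u])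
    `&` ((fun y => node y 0) @^-1` [set u | u = m0]
    `&` (fun y => node y M) @^-1` [set u | u = m1]).
  by apply/seteqP; split=> [y [ey y0 yM]|y [ey [y0 yM]]]; do ?split.
apply: closedI.
  apply: closed_bigI => k _; apply: preimage_closed; last exact: closed_ge.
  by move=> y _; exact: (@Dh_continuous R L M k y).
by apply: closedI; apply: preimage_closed;
  [move=> y _; exact: (@node_continuous R M 0 y) | exact: closed_eq
  |move=> y _; exact: (@node_continuous R M M y) | exact: closed_eq].
Qed.

(** There are finitely many cells, so one threshold serves all of them. *)
Lemma cell_threshold (A : R) : exists2 e : R, 0 < e &
  forall k s, (k < M)%N -> 0 < s <= e -> A < cell F (rho k) s.
Proof.
have : \forall e \near (0 : R)^'+,
    forall k : 'I_M, forall s, 0 < s <= e -> A < cell F (rho k) s.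
  apply: filter_forall => k; apply: cell_blowup F_lim.
  exact: rho0h_gt0.
move=> /filterI/(_ (nbhs_right_gt (0 : R)))/filter_ex[e [eP e0]].
by exists e => // k s kM; exact: (eP (Ordinal kM)).
Qed.

Lemma energy_cell_ge0 y k : uncrossed L y -> (k < M)%N ->
  0 <= cell F (rho k) (Dh L y k) * h.
Proof.
move=> y0 kM; have h0 := meshsize_gt0 L_gt0 M_gt0.
have r0 := rho0h_gt0 L_gt0 M_gt0 rho0_gt0 kM; have d0 := y0 k kM.
by apply: mulr_ge0; [apply: mulr_ge0; [apply: F_ge0; rewrite divr_ge0|]|]; rewrite ?ltW.
Qed.

Lemma cell_le_energy y k : uncrossed L y -> (k < M)%N ->
  cell F (rho k) (Dh L y k) * h <= E y.
Proof.
move=> y0 kM.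
have -> : E y = \sum_(j < M) cell F (rho j) (Dh L y j) * h by [].
rewrite (bigD1 (Ordinal kM)) //= lerDl sumr_ge0 // => j _.
exact: energy_cell_ge0.
Qed.

Variables (c s : R) (a b : 'rV[R]_M.+1).
Hypothesis c_ge0 : 0 <= c.
Hypothesis s_ge0 : 0 <= s.
Local Notation J := (objective L F rho0 c s a b).

Lemma energy_le_objective y : E y <= J y.
Proof.
have h0 := meshsize_gt0 L_gt0 M_gt0.
rewrite /objective lerDr; apply: addr_ge0; apply: mulr_ge0 => //.
- apply: sumr_ge0 => k _; rewrite mulr1; apply: mulr_ge0; last exact: ltW.
  by apply: mulr_ge0; rewrite ?sqr_ge0 // ltW // rho0h_gt0.
- by rewrite divr_ge0.
- by apply: sumr_ge0 => k _; rewrite -expr2; apply: mulr_ge0; rewrite ?sqr_ge0 ?ltW.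
Qed.

(** The threshold e is chosen so that one cell with stretching at most e already
    costs more than J(z).  Hence the competitor z and the minimiser both
    lie strictly inside the constraint D_h >= e. *)
Lemma objective_min z : Sad L z ->
  exists x, exists2 e : R, 0 < e & [/\ separated e x,
    forall k, (k < M)%N -> e < Dh L x k & forall y, separated e y -> J x <= J y].
Proof.
move=> z_ad; have h0 := meshsize_gt0 L_gt0 M_gt0.
have [e e0 eP] := cell_threshold (J z / h).
have far y : uncrossed L y -> J y <= J z -> forall k, (k < M)%N -> e < Dh L y k.
  move=> y0 yz k kM; rewrite ltNge; apply/negP => ye.
  have := eP k (Dh L y k) kM; rewrite y0 // ye => /(_ isT); rewrite ltNge => /negP.
  apply; rewrite ler_pdivlMr //.
  apply: le_trans yz; apply: le_trans (energy_le_objective y).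
  exact: cell_le_energy.
have z_sep : separated e z.
  have z_far := far z (Sad_uncrossed L_gt0 M_gt0 z_ad) (lexx _).
  by case: z_ad => _ z0 zM; split=> // k kM; rewrite ltW // z_far.
have [||x + xmin] := compact_EVT_min _ (compact_separated e0) (f := J).
- by exists z.
- apply: continuous_in_subspaceT => y; rewrite inE => /(separated_uncrossed e0) y0.
  exact: objective_continuous.
rewrite inE => x_sep; exists x, e => //; split=> // [|y y_sep].
  apply: far; first exact: separated_uncrossed x_sep.
  by apply: xmin; rewrite inE.
by apply: xmin; rewrite inE.
Qed.

(** The constraint D_h >= e is inactive at the minimiser, so Fermat's rule
    applies along every line that keeps the ends fixed. *)
Lemma objective_critical z : Sad L z -> exists2 x, Sad L x &
  forall w, fixed_ends w -> dobjective L F rho0 c s a b x w = 0.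
Proof.
move=> /objective_min[x [e e0 [x_sep x_far xmin]]].
exists x => [|w [w0 wM]]; first exact: separated_Sad x_sep.
have [d /= d0 dP] : exists2 d : R, 0 < d &
    forall r, `|r| < d -> separated e (r *: w + x).
  have : \forall r \near (0 : R), forall k : 'I_M, e < Dh L (r *: w + x) k.
    apply: (@filter_forall _ _ _ (nbhs (0 : R)) (nbhs_filter _)) => k.
    have lim0 : r * Dh L w k + Dh L x k @[r --> (0 : R)] --> 0 * Dh L w k + Dh L x k.
      by apply: cvgD; [apply: cvgMr_tmp; exact: cvg_id|exact: cvg_cst].
    have : \forall u \near 0 * Dh L w k + Dh L x k, e < u.
      by apply: lt_nbhsr; rewrite mul0r add0r x_far.
    move=> /lim0; apply: (@filterS _ (nbhs (0 : R)) (nbhs_filter _)) => r /=.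
    by rewrite Dh_scalar.
  move=> /nbhs_ballP[d /= d0 dP]; exists d => // r rd.
  case: x_sep => _ x0 xM; split; rewrite ?node_scalar ?w0 ?wM ?mulr0 ?add0r //.
  by move=> k kM; apply/ltW/(dP r _ (Ordinal kM)); rewrite /ball /= sub0r normrN.
pose g (r : R) := J (r *: w + x).
have dg (r : R) : `|r| < d -> is_derive r 1 g (dobjective L F rho0 c s a b (r *: w + x) w).
  move=> /dP/(separated_uncrossed e0) r0.
  have dJ := is_derive_objective L_gt0 M_gt0 rho0_gt0 F_smooth c s a b w r0.
  by have [+ _] := is_derive_line J x w r (dobjective L F rho0 c s a b (r *: w + x) w); apply.
have [_ g0] : is_derive (0 : R) 1 g 0.
  apply: (@derive1_at_min _ g (- d) d); rewrite ?in_itv /= ?oppr_lt0 ?d0 //.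
  - by rewrite ge0_cp // ltW.
  - by move=> r; rewrite in_itv /= -ltr_norml => /dg[].
  - move=> r; rewrite in_itv /= -ltr_norml => rd.
    by rewrite /g scale0r add0r; apply: xmin; exact: dP.
have [|_] := dg 0; first by rewrite normr0.
by rewrite g0 scale0r add0r.
Qed.

End Minimiser.

(** * The scheme as an Euler-Lagrange system *)

Section Scheme.
Variables (R : realType) (L : R) (M : nat) (F rho0 : R -> R) (t : nat -> R).
Variables (n : nat) (xp xc : 'rV[R]_M.+1).
Hypothesis L_gt0 : 0 < L.
Hypothesis M_gt0 : (0 < M)%N.
Hypothesis rho0_gt0 : forall X : R, - L <= X <= L -> 0 < rho0 X.
Hypothesis F_smooth : twice_differentiable_pos F.
Implicit Types (x y z w : 'rV[R]_M.+1).
Local Notation h := (meshsize L M).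
Local Notation delta k := (delta_mx 0 (inord k) : 'rV[R]_M.+1).
Local Notation r := (step_ratio t n.+1).

Definition inertia : R := (1 + 2 * r) / (2 * tau t n.+1 * (1 + r)).

Local Notation dJ :=
  (dobjective L F rho0 inertia (tau t n.+1) (extrapolation t n xp xc) xc).

Lemma sum_node_delta (f : nat -> R) j : (0 < j < M)%N ->
  \sum_(k < M) f k * node (delta j) k = f j
  /\ \sum_(k < M) f k * node (delta j) k.+1 = f j.-1.
Proof.
case/andP=> j0 jM; have jM' : (j <= M)%N := ltnW jM.
have pM : (j.-1 < M)%N by rewrite (leq_ltn_trans (leq_pred j)).
split.
- rewrite (bigD1 (Ordinal jM)) //= node_delta // eqxx mulr1 big1 ?addr0 // => k kj.
  by rewrite node_delta // 1?ltnW // (negPf (_ : k != j :> nat)) ?mulr0.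
- rewrite (bigD1 (Ordinal pM)) //= node_delta // prednK // eqxx mulr1 big1 ?addr0 //.
  move=> k kj; rewrite node_delta // -[X in _ == X](prednK j0) eqSS.
  by rewrite (negPf (_ : k != j.-1 :> nat)) ?mulr0.
Qed.

Lemma hdot_midpt_delta (f : nat -> R) j : (0 < j < M)%N ->
  hdot L M f (midpt (delta j)) = 2^-1 * (f j + f j.-1) * h.
Proof.
move=> jM; have [<- <-] := sum_node_delta f jM.
rewrite -big_split /= mulr_sumr mulr_suml /hdot; apply: eq_bigr => k _.
by rewrite /midpt; ring.
Qed.

Lemma hdot_Dh_delta (f : nat -> R) j : (0 < j < M)%N ->
  hdot L M f (Dh L (delta j)) = f j.-1 - f j.
Proof.
move=> jM; have [<- <-] := sum_node_delta f jM.
rewrite -sumrB /hdot; apply: eq_bigr => k _.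
by rewrite /Dh; field; rewrite lt0r_neq0 // meshsize_gt0.
Qed.

(** Node j belongs to the cells j - 1 and j only, which yields the two inertial
    terms of the scheme and, by summation by parts, its second difference. *)
Lemma scheme_residual_dobjective x j : uncrossed L x -> (0 < j < M)%N ->
  scheme_residual L F rho0 t n xp xc x j = dJ x (delta j).
Proof.
move=> x0 jM; rewrite /scheme_residual /dobjective.
rewrite hdot_midpt_delta // hdot_Dh_delta // -/inertia /partial.
have [_ ->] := is_derive_energy L_gt0 M_gt0 rho0_gt0 F_smooth (delta j) x0.
have hn0 : h != 0 by rewrite lt0r_neq0 // meshsize_gt0.
have j1 : j.-1.+1 = j by rewrite prednK //; case/andP: jM.
congr (_ + _); rewrite !(midptB x) !DhB /Dh j1; move: inertia => c.
by field.
Qed.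

Lemma schemeP x : Sad L x -> scheme L F rho0 t n xp xc x <->
  forall w, fixed_ends w -> dJ x w = 0.
Proof.
move=> x_ad; have x0 := Sad_uncrossed L_gt0 M_gt0 x_ad; split.
- case=> _ _ res0 w w0.
  have lin := @dobjective_scalar _ L M F rho0 inertia (tau t n.+1)
    (extrapolation t n xp xc) xc x.
  rewrite (scalar_interior_sum M_gt0 lin w0) big1 // => i _.
  have iM : (i.+1 < M)%N by rewrite -[X in (_ < X)%N](prednK M_gt0) ltnS.
  by rewrite -scheme_residual_dobjective // res0 ?mulr0.
- move=> dJ0; case: (x_ad) => _ x_0 x_M; split=> // j j1 jM.
  rewrite scheme_residual_dobjective ?j1 //; apply: dJ0.
  split; rewrite node_delta // 1?ltnW //.
    by rewrite ltn_eqF.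
  by rewrite gtn_eqF.
Qed.

End Scheme.

(** * Energy dissipation and the main result *)

Section Dissipation.
Variable R : realType.
Implicit Types (r m a b : R).

(** The difference of the two sides is concave in r after clearing denominators,
    so only the ends r = 0 and r = m matter. *)
Lemma ratio_gap r m : 0 < r <= m -> m <= (3 + Num.sqrt 17) / 2 ->
  m / (1 + m) <= (2 + 4 * r - r ^+ 2) / (1 + r).
Proof.
move=> /andP[r0 rm] m_le; have m0 : 0 < m by exact: lt_le_trans rm.
have s17 : Num.sqrt 17 ^+ 2 = 17 :> R by rewrite sqr_sqrtr.
have s0 : 0 <= Num.sqrt 17 :> R := sqrtr_ge0 _.
have m2 : m ^+ 2 <= 3 * m + 2.
  move: m_le s17 s0; set q := Num.sqrt 17 => m_le q17 q0.
  have q3 : 3 <= q by nra.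
  have : 0 <= ((3 + q) / 2 - m) * (m - (3 - q) / 2) by apply: mulr_ge0; lra.
  have -> : ((3 + q) / 2 - m) * (m - (3 - q) / 2)
    = 3 * m - m ^+ 2 + (q ^+ 2 - 9) / 4 by field.
  by rewrite q17; lra.
rewrite ler_pdivrMr; last lra.
rewrite mulrAC ler_pdivlMr; last lra.
(* Multiplied by m, the cleared inequality is the chord between r = 0 and r = m
   plus the concavity excess. *)
rewrite -subr_ge0 -(pmulr_rge0 _ m0).
have -> : m * ((2 + 4 * r - r ^+ 2) * (1 + m) - m * (1 + r)) =
  (m - r) * (2 + m) + r * (1 + m) * (3 * m + 2 - m ^+ 2) + r * (m - r) * (1 + m) * m.
  by ring.
apply: addr_ge0; [apply: addr_ge0|]; repeat (apply: mulr_ge0); lra.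
Qed.

(** The cellwise balance: completing the square in a - b (Young's inequality)
    leaves multiples of a^2 and b^2, nonnegative by [ratio_gap] and by
    monotonicity of r/(1+r). *)
Lemma step_dissipation (tau0 tau1 r m a b : R) : 0 < tau0 ->
  tau1 = r * tau0 -> 0 < r <= m -> m <= (3 + Num.sqrt 17) / 2 ->
  m / (2 * tau1 * (1 + m)) * a ^+ 2 - m / (2 * tau0 * (1 + m)) * b ^+ 2
  <= 2 * ((1 + 2 * r) / (2 * tau1 * (1 + r))) *
     ((a - r ^+ 2 / (1 + 2 * r) * b) * a).
Proof.
move=> t0 t1E r_bnd m_le; have gap := ratio_gap r_bnd m_le.
have /andP[r0 rm] := r_bnd; have m0 : 0 < m by exact: lt_le_trans rm.
have t1 : 0 < tau1 by rewrite t1E mulr_gt0.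
have mono : r / (1 + r) <= m / (1 + m).
  rewrite ler_pdivrMr; last lra.
  by rewrite mulrAC ler_pdivlMr; [lra|lra].
rewrite -subr_ge0.
set p := m / (1 + m) in gap mono *.
have -> : 2 * ((1 + 2 * r) / (2 * tau1 * (1 + r))) *
     ((a - r ^+ 2 / (1 + 2 * r) * b) * a) -
   (m / (2 * tau1 * (1 + m)) * a ^+ 2 - m / (2 * tau0 * (1 + m)) * b ^+ 2) =
   (2 * tau1)^-1 * (((2 + 4 * r - r ^+ 2) / (1 + r) - p) * a ^+ 2
     + r * (p - r / (1 + r)) * b ^+ 2 + r ^+ 2 / (1 + r) * (a - b) ^+ 2).
  by rewrite t1E /p; field; rewrite ?lt0r_neq0 //; lra.
apply: mulr_ge0; first by rewrite invr_ge0; lra.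
apply: addr_ge0; [apply: addr_ge0|]; apply: mulr_ge0; rewrite ?sqr_ge0 //.
- by rewrite subr_ge0.
- by apply: mulr_ge0; [exact: ltW|rewrite subr_ge0].
- by apply: divr_ge0; [exact: sqr_ge0|lra].
Qed.

End Dissipation.

Theorem theorem4p2 (R : realType) (L : R) (M : nat) (F rho0 : R -> R)
    (t : nat -> R) (n : nat) (xp xc : 'rV[R]_M.+1)
    (L_gt0 : 0 < L) (M_gt0 : (0 < M)%N)
    (rho0_gt0 : forall X : R, - L <= X <= L -> 0 < rho0 X)
    (F_ge0 : forall s : R, 0 <= s -> 0 <= F s)
    (F_smooth : twice_differentiable_pos F)
    (F_lim : (F (1 / s) * s @[s --> 0^'+] --> +oo%R))
    (tau_gt0 : forall k : nat, (1 <= k)%N -> 0 < tau t k)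
    (n_ge1 : (1 <= n)%N)
    (xp_ad : Sad L xp) (xc_ad : Sad L xc)
    (hess_gt0 : forall y : 'rV[R]_M.+1, Sad L y ->
       posdefmx (hessian_int (energy L F rho0) y)) :
  exists x : 'rV[R]_M.+1,
    [/\ unique (fun y => Sad L y /\ scheme L F rho0 t n xp xc y) x,
        forall j : nat, (j < M)%N -> 0 < density L rho0 x j,
        mass_conservative L rho0 x &
        forall rmax : R,
          (forall k : nat, (2 <= k)%N -> 0 < step_ratio t k <= rmax) ->
          rmax <= (3 + Num.sqrt 17) / 2 ->
          energy L F rho0 x
            + rmax / (2 * tau t n.+1 * (1 + rmax)) * wnorm2 L rho0 (x - xc)
          <= energy L F rho0 xc
            + rmax / (2 * tau t n * (1 + rmax)) * wnorm2 L rho0 (xc - xp)].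
Proof.
have t1 : 0 < tau t n.+1 by exact: tau_gt0.
have t0 : 0 < tau t n by exact: tau_gt0.
have r0 : 0 < step_ratio t n.+1 by rewrite /step_ratio /= divr_gt0.
have c0 : 0 <= inertia t n.
  by rewrite /inertia divr_ge0 //; [lra|apply: mulr_ge0; lra].
have s0 := ltW t1; have h0 := meshsize_gt0 L_gt0 M_gt0.
have [x x_ad x_crit] := objective_critical L_gt0 M_gt0 rho0_gt0 F_ge0 F_smooth
  F_lim (extrapolation t n xp xc) xc c0 s0 xc_ad.
have x_unc := Sad_uncrossed L_gt0 M_gt0 x_ad.
exists x; split.
- split=> [|y [y_ad]].
    by split=> //; apply/schemeP.
  (* Two critical points contradict strict monotonicity of the gradient. *)
  move=> /(schemeP t n xp xc L_gt0 M_gt0 rho0_gt0 F_smooth y_ad) y_crit.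
  apply: contrapT => /eqP xy.
  have w0 := fixed_endsB x_ad y_ad.
  have := dobjective_increasing F L_gt0 M_gt0 rho0_gt0
    (extrapolation t n xp xc) xc x y c0 s0.
  rewrite x_crit // y_crit // subrr subr_le0 leNgt.
  by rewrite denergy_increasing.
- move=> j jM; apply: divr_gt0; [exact: rho0h_gt0|exact: x_unc].
- apply: eq_bigr => j _; have := x_unc j (ltn_ord j); rewrite /density /Dh => d0.
  have dn0 : node x j.+1 - node x j != 0.
    by apply: contraTneq d0 => ->; rewrite mulr0 ltxx.
  by field; rewrite dn0 lt0r_neq0.
- move=> m ratio_le m_le.
  have t1E : tau t n.+1 = step_ratio t n.+1 * tau t n.
    by rewrite /step_ratio divfK // lt0r_neq0.
  have tan := energy_tangent L_gt0 M_gt0 rho0_gt0 F_smooth hess_gt0 xc_ad x_ad.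
  have := x_crit _ (fixed_endsB xc_ad x_ad); rewrite /dobjective.
  set H := hdot L M _ (midpt _); set D := hdot L M (Dh L _) _ => crit.
  (* The second difference term is dissipative and is dropped. *)
  have D0 : 0 <= tau t n.+1 * D.
    apply: mulr_ge0 => //; apply: sumr_ge0 => k _; rewrite -expr2.
    by apply: mulr_ge0; rewrite ?sqr_ge0 // ltW.
  suff : m / (2 * tau t n.+1 * (1 + m)) * wnorm2 L rho0 (x - xc)
     - m / (2 * tau t n * (1 + m)) * wnorm2 L rho0 (xc - xp)
     <= 2 * inertia t n * H by lra.
  rewrite /wnorm2 /H /hdot !mulr_sumr -sumrB; apply: ler_sum => k _.
  have rho_gt0 := rho0h_gt0 L_gt0 M_gt0 rho0_gt0 (ltn_ord k).
  have xhE : midpt (x - extrapolation t n xp xc) k =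
     midpt (x - xc) k - step_ratio t n.+1 ^+ 2 / (1 + 2 * step_ratio t n.+1)
        * midpt (xc - xp) k.
    rewrite /midpt !nodeB /extrapolation /node !mxE.
    by field; rewrite lt0r_neq0 //; lra.
  rewrite xhE; set A := midpt (x - xc) k; set B := midpt (xc - xp) k.
  have key := step_dissipation A B t0 t1E (ratio_le n.+1 n_ge1) m_le.
  have := ler_wpM2r (ltW (mulr_gt0 rho_gt0 h0)) key.
  rewrite /inertia; set e0 := m / (2 * tau t n * _).
  set e1 := m / _; set e2 := _ / _ => le_k; rewrite -subr_ge0.
  rewrite -subr_ge0 in le_k; apply: (le_trans le_k).
  rewrite le_eqVlt; apply/orP; left; apply/eqP; ring.
Qed.
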